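(* Let $G$ be a Polish group admitting a Lévy net of probability measures converging to invariance with regard to the Monge-Kantorovich distance. Then every ergodic weakly continuous near-action of $G$ on a standard Lebesgue probability space is whirly.
   Context: A net $(\nu_\beta)$ of Borel probability measures on a Polish group $G$ is a Lévy net (concentrates) with respect to the right uniform structure of $G$ if for every net of Borel sets $A_\beta\subseteq G$ (same index set) with $\liminf_\beta\nu_\beta(A_\beta)>0$ and every open neighbourhood $V$ of the identity, $\lim_\beta\nu_\beta(VA_\beta)=1$. For a metric space $(Y,d)$ and Borel probability measures $\mu_1,\mu_2$ on $Y$, the Monge-Kantorovich distance is $d_{MK}(\mu_1,\mu_2)=\inf\int_{Y\times Y}d(x,y)\,d\nu$, the infimum over all Borel probability measures $\nu$ on $Y\times Y$ with marginals $\mu_1,\mu_2$. For $g\in G$ and a measure $\nu$ on $G$, $g\ast\nu$ is the push-forward of $\nu$ under $x\mapsto gx$. A net $(\nu_\beta)$ converges to invariance in the sense of the Monge-Kantorovich distance if, for $d$ a compatible right-invariant metric on $G$, $d_{MK}(g\ast\nu_\beta,\nu_\beta)\to0$ for every $g\in G$. A standard Lebesgue probability space $(X,\mu)$ is a standard Borel space with a non-atomic Borel probability measure. $\mathrm{Aut}(X,\mu)$ is the group of measure-preserving automorphisms of $(X,\mu)$ (modulo equality a.e.) with the weak topology, the weakest one making all maps $g\mapsto\mu(A\bigtriangleup gA)$, $A$ Borel, continuous. A weakly continuous near-action of $G$ on $(X,\mu)$ is a continuous homomorphism $G\to\mathrm{Aut}(X,\mu)$. It is ergodic if every measurable $A$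 with $\mu(A\bigtriangleup gA)=0$ for all $g\in G$ has measure $0$ or $1$. It is whirly if for every measurable $A\subseteq X$ with $\mu(A)>0$ and every neighbourhood $V$ of the identity in $G$ the set $VA$ has full measure, where $VA$ is defined up to a null set as $\bigcup_n v_nA$ for a countable dense subset $\{v_n\}$ of $V$. *)

(* Defs.v *)
From HB Require Import structures.
From mathcomp Require Import all_boot all_order all_algebra.
From mathcomp Require Import all_classical all_reals all_analysis.

Set Implicit Arguments.
Unset Strict Implicit.
Unset Printing Implicit Defensive.

Import Order.TTheory GRing.Theory Num.Theory.
Import numFieldNormedType.Exports.

Local Open Scope classical_set_scope.
Local Open Scope ring_scope.

(* Topological groups. The base point comes only from the library, whose
   measurable types are all pointed; it plays no role. *)

HB.mixin Record isTopologicalGroup G of PointedTopological G & Group G := {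
  mulg_continuous : continuous (fun xy : G * G => (xy.1 * xy.2)%g) ;
  invg_continuous : continuous (fun x : G => (x^-1)%g)
}.

#[short(type="topologicalGroupType")]
HB.structure Definition TopologicalGroup :=
  {G of PointedTopological G & Group G & isTopologicalGroup G}.

Section metrics.
Context {R : realType} {T : ptopologicalType}.

Record is_metric (d : T -> T -> R) : Prop := IsMetric {
  metric_ge0 : forall x y, 0 <= d x y ;
  metric_eq0 : forall x y, d x y = 0 <-> x = y ;
  metric_sym : forall x y, d x y = d y x ;
  metric_triangle : forall x y z, d x z <= d x y + d y z
}.

Definition compatible (d : T -> T -> R) :=
  forall x : T, nbhs x = filter_from [set e : R | 0 < e]
                           (fun e => [set y | d x y < e]).

Definition complete_for (d : T -> T -> R) :=
  forall u : nat -> T,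
    (forall e : R, 0 < e -> exists N, forall m n,
       (N <= m)%N -> (N <= n)%N -> d (u m) (u n) < e) ->
    exists l : T, u @ \oo --> l.

End metrics.

Definition polish (R : realType) (T : ptopologicalType) :=
  (exists D : set T, countable D /\ dense D) /\
  (exists d : T -> T -> R, [/\ is_metric d, compatible d & complete_for d]).

Notation borel T := (g_sigma_algebraType (@open T)).

Section Monge_Kantorovich.
Context {R : realType} {T : ptopologicalType}.
Local Open Scope ereal_scope.

(* m lives on the Borel sigma-algebra of the product topology *)
Definition coupling (mu1 mu2 : probability (borel T) R)
    (m : probability (borel (T * T)%type) R) :=
  forall A : set (borel T), measurable A ->
    m (fst @^-1` A) = mu1 A /\ m (snd @^-1` A) = mu2 A.

Definition dMK (d : T -> T -> R) (mu1 mu2 : probability (borel T) R) : \bar R :=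
  ereal_inf [set \int[m]_z (d z.1 z.2)%:E | m in coupling mu1 mu2].

End Monge_Kantorovich.

Section translation.
Context {R : realType} {G : topologicalGroupType}.

Definition ltrans (g : G) : borel G -> borel G := fun x => ((g : G) * (x : G))%g.

Lemma ltrans_continuous (g : G) : continuous (ltrans g : G -> G).
Proof.
move=> x; rewrite /ltrans.
apply: (@continuous2_cvg _ _ _ _ _ _ _ _ (fun a b : G => (a * b)%g)).
- exact: (@mulg_continuous G (g, x)).
- exact: cvg_cst.
- exact: cvg_id.
Qed.

Lemma measurable_ltrans (g : G) : measurable_fun setT (ltrans g).
Proof.
apply: (@measurability _ _ _ _ setT (ltrans g) (@open G)) => //.
move=> _ [B oB <-]; rewrite setTI; apply: sub_sigma_algebra.
by apply: open_comp => // x _; exact: ltrans_continuous.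
Qed.

HB.instance Definition _ (g : G) :=
  isMeasurableFun.Build _ _ _ _ (ltrans g) (measurable_ltrans g).

Definition translate (g : G) (nu : probability (borel G) R) :
    probability (borel G) R :=
  distribution nu (ltrans g).

End translation.

(* Nets: families indexed by a nonempty directed preorder *)

Section nets.
Context {disp : Order.disp_t} (I : preorderType disp).

Definition directed :=
  [set: I] !=set0 /\ forall i j : I, exists k : I, (i <= k)%O /\ (j <= k)%O.

Definition eventually_net : set_system I :=
  filter_from [set: I] (fun i => [set j | (i <= j)%O]).

Definition net_liminf {R : realType} (f : I -> \bar R) : \bar R :=
  ereal_sup [set ereal_inf [set f j | j in [set j | (i <= j)%O]] | i in [set: I]].

End nets.
Arguments eventually_net {disp} I.

Section Levy_nets.
Context {R : realType} {G : topologicalGroupType}.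
Context {disp : Order.disp_t} {I : preorderType disp}.
Local Open Scope ereal_scope.

Definition mulset (V A : set G) : set G :=
  [set (v * a)%g | v in V & a in A].

Definition Levy_net (nu : I -> probability (borel G) R) :=
  forall A : I -> set (borel G), (forall i, measurable (A i)) ->
    0 < net_liminf (fun i => nu i (A i)) ->
  forall V : set G, open V -> V 1%g ->
    nu i (mulset V (A i)) @[i --> eventually_net I] --> 1.

Definition right_invariant (d : G -> G -> R) :=
  forall x y g : G, d (x * g)%g (y * g)%g = d x y.

(* The condition does not depend on the metric d when d is bounded, and is
   weakest for bounded ones; hence the existential quantifier on d. *)
Definition MK_invariant_net (nu : I -> probability (borel G) R) :=
  exists d : G -> G -> R,
    [/\ is_metric d, compatible d, right_invariant d &
        forall g : G,
          dMK d (translate g (nu i)) (nu i) @[i --> eventually_net I] --> 0].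

End Levy_nets.

Definition standard_borel (R : realType) d (X : measurableType d) :=
  exists (P : ptopologicalType) (f : X -> borel P) (g : borel P -> X),
    [/\ polish R P, measurable_fun setT f, measurable_fun setT g,
        cancel f g & cancel g f].

Definition nonatomic (R : realType) d (X : measurableType d)
    (mu : probability X R) :=
  forall A, measurable A -> (0 < mu A)%E ->
    exists B, [/\ measurable B, B `<=` A, (0 < mu B)%E & (mu B < mu A)%E].

Section automorphisms.
Context {R : realType} {d : measure_display} {X : measurableType d}.
Variable mu : probability X R.

Record mpaut := MPAut {
  mpfun :> X -> X ;
  mpinv : X -> X ;
  mpfunK : cancel mpfun mpinv ;
  mpinvK : cancel mpinv mpfun ;
  measurable_mpfun : measurable_fun setT mpfun ;
  measurable_mpinv : measurable_fun setT mpinv ;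
  mpfun_pres : forall A, measurable A -> mu (mpfun @^-1` A) = mu A
}.

HB.instance Definition _ := gen_eqMixin mpaut.
HB.instance Definition _ := gen_choiceMixin mpaut.

Definition ae_eqb (f g : mpaut) : bool := `[< \forall x \ae mu, f x = g x >].

Lemma ae_eqb_refl : reflexive ae_eqb.
Proof. by move=> f; apply/asboolP; exact: aeW. Qed.

Lemma ae_eqb_sym : symmetric ae_eqb.
Proof.
by move=> f g; apply/asboolP/asboolP; apply: filterS => x /esym.
Qed.

Lemma ae_eqb_trans : transitive ae_eqb.
Proof.
move=> g f h /asboolP fg /asboolP gh; apply/asboolP.
by apply: filterS2 fg gh => x -> ->.
Qed.

Definition ae_equiv := EquivRel ae_eqb ae_eqb_refl ae_eqb_sym ae_eqb_trans.

Definition aut := {eq_quot ae_equiv}%qT.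
HB.instance Definition _ := EqQuotient.on aut.
HB.instance Definition _ := Choice.on aut.

Lemma aut_eqP (f g : mpaut) :
  (\pi_aut f = \pi_aut g)%qT <-> \forall x \ae mu, f x = g x.
Proof. by split=> [/eqmodP/asboolP//|fg]; apply/eqmodP/asboolP. Qed.

Lemma ae_repr_pi (f : mpaut) : \forall x \ae mu, repr (\pi_aut f)%qT x = f x.
Proof. by apply/aut_eqP; rewrite reprK. Qed.

Lemma mpinv_pres (f : mpaut) A : measurable A -> mu (mpinv f @^-1` A) = mu A.
Proof.
move=> mA; rewrite -[LHS](mpfun_pres f); last first.
  by rewrite -[X in measurable X]setTI; exact: measurable_mpinv.
by rewrite -comp_preimage (_ : _ \o _ = id)//; apply/funext => x; exact: mpfunK.
Qed.

Lemma ae_comp_pres (P : X -> Prop) (f : X -> X) : measurable_fun setT f ->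
  (forall A, measurable A -> mu (f @^-1` A) = mu A) ->
  (\forall x \ae mu, P x) -> \forall x \ae mu, P (f x).
Proof.
move=> mf fmu [N [mN N0 PN]]; exists (f @^-1` N); split.
- by rewrite -[X in measurable X]setTI; exact: mf.
- by rewrite fmu.
- by move=> x /= /PN.
Qed.

Definition mpaut1 : mpaut :=
  @MPAut id id (fun=> erefl) (fun=> erefl) (@measurable_id _ _ _)
    (@measurable_id _ _ _) (fun A _ => erefl).

Section composition.
Variables f g : mpaut.

Lemma measurable_mpfun_comp : measurable_fun setT (f \o g).
Proof. by apply: measurableT_comp; exact: measurable_mpfun. Qed.

Lemma measurable_mpinv_comp : measurable_fun setT (mpinv g \o mpinv f).
Proof. by apply: measurableT_comp; exact: measurable_mpinv. Qed.

Lemma mpfun_comp_pres A : measurable A -> mu ((f \o g) @^-1` A) = mu A.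
Proof.
move=> mA; rewrite comp_preimage !mpfun_pres//.
by rewrite -[X in measurable X]setTI; exact: measurable_mpfun.
Qed.

Definition mpautM : mpaut :=
  MPAut (can_comp (mpfunK f) (mpfunK g)) (can_comp (mpinvK g) (mpinvK f))
    measurable_mpfun_comp measurable_mpinv_comp mpfun_comp_pres.

End composition.

Definition mpautV (f : mpaut) : mpaut :=
  MPAut (mpinvK f) (mpfunK f) (measurable_mpinv f) (measurable_mpfun f)
    (mpinv_pres f).

Definition aut1 : aut := (\pi_aut mpaut1)%qT.
Definition autM (f g : aut) : aut := (\pi_aut (mpautM (repr f) (repr g)))%qT.
Definition autV (f : aut) : aut := (\pi_aut (mpautV (repr f)))%qT.

Lemma autM_pi (f g : mpaut) :
  (autM (\pi_aut f) (\pi_aut g) = \pi_aut (mpautM f g))%qT.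
Proof.
apply/aut_eqP => /=.
have := ae_comp_pres (measurable_mpfun g) (mpfun_pres g) (ae_repr_pi f).
by apply: filterS2 (ae_repr_pi g) => x -> ->.
Qed.

Lemma autV_pi (f : mpaut) : (autV (\pi_aut f) = \pi_aut (mpautV f))%qT.
Proof.
apply/aut_eqP => /=.
have := ae_comp_pres (measurable_mpinv f) (mpinv_pres f) (ae_repr_pi f).
apply: filterS => x; rewrite mpinvK => fx.
by apply: (can_inj (mpfunK (repr (\pi_aut f)%qT))); rewrite mpinvK fx.
Qed.

Lemma autMA : associative autM.
Proof.
elim/quotW=> f; elim/quotW=> g; elim/quotW=> h.
rewrite (autM_pi g h) (autM_pi f g) (autM_pi f) (autM_pi _ h).
by apply/aut_eqP; exact: aeW.
Qed.

Lemma aut1M : left_id aut1 autM.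
Proof.
by move=> f; rewrite -[f]reprK autM_pi; apply/aut_eqP; exact: aeW.
Qed.

Lemma autM1 : right_id aut1 autM.
Proof.
by move=> f; rewrite -[f]reprK autM_pi; apply/aut_eqP; exact: aeW.
Qed.

Lemma autVM : left_inverse aut1 autV autM.
Proof.
move=> f; rewrite -[f]reprK autV_pi autM_pi.
by apply/aut_eqP; apply: aeW => x /=; rewrite mpfunK.
Qed.

Lemma autMV : right_inverse aut1 autV autM.
Proof.
move=> f; rewrite -[f]reprK autV_pi autM_pi.
by apply/aut_eqP; apply: aeW => x /=; rewrite mpinvK.
Qed.

HB.instance Definition _ :=
  isGroup.Build aut autMA aut1M autM1 autVM autMV.

(* g A, for a fixed representative of g: well defined up to a null set *)
Definition aut_act (g : aut) (A : set X) : set X := (repr g : mpaut) @` A.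

(* weak topology: the coarsest one for which all the maps
   g |-> mu (A `+` g A), A measurable, are continuous *)
HB.instance Definition _ := @isSubBaseTopological.Build aut
  (set X * set (\bar R))%type
  [set AU | measurable AU.1 /\ open AU.2]
  (fun AU => [set g | AU.2 (mu (AU.1 `+` aut_act g AU.1))]).

End automorphisms.

Section near_actions.
Context {R : realType} {G : topologicalGroupType}.
Context {d : measure_display} {X : measurableType d} {mu : probability X R}.
Implicit Type phi : {multiplicative G -> aut mu}.

Definition ergodic phi :=
  forall A, measurable A -> (forall g, mu (A `+` aut_act (phi g) A) = 0%E) ->
    mu A = 0%E \/ mu A = 1%E.

(* V A, defined up to a null set, is the union of the v n A for any sequence v
   dense in V *)
Definition whirly phi :=
  forall A, measurable A -> (0 < mu A)%E ->
  forall V : set G, nbhs 1%g V ->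
  forall v : nat -> G, (forall n, V (v n)) -> V `<=` closure (range v) ->
    mu (\bigcup_n aut_act (phi (v n)) A) = 1%E.

End near_actions.

(* Main.v *)
Require Import Defs.
From mathcomp Require Import all_boot all_order all_algebra.
From mathcomp Require Import all_classical all_reals all_analysis.
From mathcomp Require Import measurable_realfun lra.



(** Suppose that [V A] misses a set [B] of positive measure. Then no point of
    [A] can be moved into [B] by an element of [V], up to null sets. For a
    point [x], look at the two sets of group elements which move [x] into [A],
    respectively into [B]. Translating the first one on the left by a small
    neighbourhood of the identity does not reach the second one, so by
    concentration one of the two has small [nu_i]-measure. Writing [p_A x] and
    [p_B x] for these measures, the product [p_A * p_B] is therefore small at
    almost every [x], hence so is its integral.

    Invariance and ergodicity give the opposite bound. For a measurable [E] put
    [m E] for the integral of [p_A * p_E]; it is subadditive in [E], it is at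
    most [mu E], and its value on the whole space is [mu A]. As a function of
    [E], [m] is the average over [g] of [psi_E g], the integral of [p_A] over
    the preimage of [E] under [g]. Weak continuity of the action makes [psi_E]
    uniformly continuous for a right-invariant metric, with a modulus which does
    not depend on [nu_i]. A Monge-Kantorovich estimate then shows that [m B] and
    [m (h^-1 B)] differ little when [nu_i] is almost invariant under [h]. By
    ergodicity and separability, finitely many sets [h_j^-1 B] cover the space
    up to measure [mu A / 2]. Their number is fixed before [i] is chosen, so
    smallness of [m B] makes all the [m (h_j^-1 B)] small together, and
    [mu A <= mu A / 2 + sum_j m (h_j^-1 B) < mu A].

    A near-action has no jointly measurable version at hand, so [p_A] is defined
    by first rounding [g] to a point of a countable dense sequence
    ([rounded_act]); in [m], only the factor [p_A] is rounded. The two bounds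
    are [hitting_product_small] and [separated_mass_bound]; they rest on
    [Levy_uniform], [dMK_integral_le], [act_uniformly_continuous] and
    [ergodic_finite_orbit]. *)

Set Implicit Arguments.
Unset Strict Implicit.
Unset Printing Implicit Defensive.

Import Order.TTheory GRing.Theory Num.Theory.
Import numFieldNormedType.Exports.

Local Open Scope classical_set_scope.
Local Open Scope ring_scope.

(** * Null sets and the weak topology *)

Section null_sets.
Context {R : realType} {d : measure_display} {X : measurableType d}.
Variable mu : probability X R.

Lemma measure_ae_eq (D E : set X) : measurable D -> measurable E ->
  (\forall x \ae mu, D x <-> E x) -> mu D = mu E.
Proof.
move=> mD mE DE.
have null (P Q : set X) : measurable P -> measurable Q ->
    (\forall x \ae mu, P x -> Q x) -> mu (P `\` Q) = 0%E.
  move=> mP mQ PQ; apply/negligibleP; first exact: measurableD.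
  by apply: negligibleS PQ => x [Px nQx] /(_ Px).
have -> : mu D = (mu (D `\` E) + mu (D `&` E))%E by exact: measureDI.
have -> : mu E = (mu (E `\` D) + mu (E `&` D))%E by exact: measureDI.
rewrite (null D E)//; last by apply: filterS DE => x [].
by rewrite (null E D)// 1?setIC//; apply: filterS DE => x [].
Qed.

Lemma integral_probability_cst (c : \bar R) : (\int[mu]__ c = c)%E.
Proof.
rewrite (integral_cst mu measurableT c) -[RHS]mule1.
by congr (_ * _)%E; exact: probability_setT.
Qed.

Lemma open_weak_ball (E : set X) (e : R) : measurable E ->
  open [set a : aut mu | (mu (E `+` aut_act a E) < e%:E)%E].
Proof.
move=> mE.
have oe : open [set y : \bar R | (y < e%:E)%E] by exact: open_ereal_lt_ereal.
exists [set [set a : aut mu | (mu (E `+` aut_act a E) < e%:E)%E]].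
  move=> _ ->; exact: (@finI_from1 _ _ _ _ (E, [set y | (y < e%:E)%E])).
by rewrite bigcup_set1.
Qed.

End null_sets.

(** * The near-action as a family of almost everywhere defined maps *)

Section near_action.
Context {R : realType} {G : topologicalGroupType}.
Context {d : measure_display} {X : measurableType d} {mu : probability X R}.
Variable phi : {multiplicative G -> aut mu}.

(** All computations are made with preimages under these representatives,
    which are measurable without further ado; the identities of the group hold
    only almost everywhere. *)
Definition act (g : G) : mpaut mu := repr (phi g).

Lemma measurable_act_preimage g (E : set X) :
  measurable E -> measurable (act g @^-1` E).
Proof.
by move=> mE; rewrite -[X in measurable X]setTI; exact: measurable_mpfun.
Qed.

Lemma measure_act_preimage g (E : set X) :
  measurable E -> mu (act g @^-1` E) = mu E.
Proof. exact: mpfun_pres. Qed.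

Lemma aut_act_preimage g (E : set X) :
  aut_act (phi g) E = mpinv (act g) @^-1` E.
Proof.
apply/seteqP; split=> [_ [x Ex <-]|x Ex] /=; first by rewrite mpfunK.
by exists (mpinv (act g) x) => //; rewrite -/(act g) mpinvK.
Qed.

Lemma measurable_aut_act g (E : set X) :
  measurable E -> measurable (aut_act (phi g) E).
Proof.
move=> mE; rewrite aut_act_preimage -[X in measurable X]setTI.
exact: measurable_mpinv.
Qed.

Lemma act_preimage_act g (E : set X) : act g @^-1` aut_act (phi g) E = E.
Proof.
by rewrite aut_act_preimage; apply/funext => x /=; rewrite mpfunK.
Qed.

Lemma actM_ae g h : \forall x \ae mu, act (g * h)%g x = act g (act h x).
Proof.
have := ae_repr_pi (mpautM (act g) (act h)).
by rewrite /act gmulfM.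
Qed.

(** Writing [h = (h g^-1) g] and transporting by [g], the position of two
    preimages relative to each other depends on [h g^-1] alone. This is where
    right-invariant metrics enter: [dG g h = dG 1 (h g^-1)]. *)
Lemma act_preimageI (g h : G) (A B : set X) : measurable A -> measurable B ->
  mu (act g @^-1` A `&` act h @^-1` B) =
  mu (aut_act (phi (h * g^-1)%g) A `&` B).
Proof.
move=> mA mB; set v := (h * g^-1)%g.
have mgA k := measurable_act_preimage k mA.
have mgB k := measurable_act_preimage k mB.
transitivity (mu (act g @^-1` (A `&` act v @^-1` B))).
  apply: measure_ae_eq.
  - exact: measurableI.
  - by apply: measurable_act_preimage; exact: measurableI.
  - apply: filterS (actM_ae v g) => x /=.
    by rewrite /v -mulgA mulVg mulg1 => ->.
rewrite measure_act_preimage; last exact: measurableI.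
have mvA := measurable_aut_act v mA.
rewrite -(measure_act_preimage v (measurableI _ _ mvA mB)).
by rewrite preimage_setI act_preimage_act.
Qed.

Lemma act_displacement (g h : G) (E : set X) : measurable E ->
  mu (act g @^-1` E `\` act h @^-1` E) =
  mu (aut_act (phi (h * g^-1)%g) E `\` E).
Proof.
move=> mE; rewrite !setDE -act_preimageI//; exact: measurableC.
Qed.

Lemma act1_ae : \forall x \ae mu, act 1%g x = x.
Proof.
apply: filterS (actM_ae 1%g 1%g) => x; rewrite mulg1.
by move=> /(can_inj (mpfunK _))/esym.
Qed.

Lemma aut_act_ae g (E : set X) :
  \forall x \ae mu, aut_act (phi g) E x <-> E (act (g^-1)%g x).
Proof.
apply: filterS2 act1_ae (actM_ae g g^-1%g) => x.
by rewrite mulgV aut_act_preimage /= => -> {1}->; rewrite mpfunK.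
Qed.

Hypothesis cont_phi : continuous phi.

(** Continuity of [phi] at the identity, tested on the subbasic neighbourhood
    attached to [E]. *)
Lemma near_displacement (E : set X) (e : R) : measurable E -> 0 < e ->
  \forall v \near (1 : G)%g, (mu (aut_act (phi v) E `\` E) < e%:E)%E.
Proof.
move=> mE e0.
have mgE g := measurable_aut_act g mE.
have : nbhs (phi 1%g) [set a : aut mu | (mu (E `+` aut_act a E) < e%:E)%E].
  apply: open_nbhs_nbhs; split; first exact: open_weak_ball.
  rewrite /= (_ : mu _ = 0%E) ?lte_fin//.
  rewrite (@measure_ae_eq _ _ _ mu _ set0) ?measure0//.
    by apply: measurableU; exact: measurableD.
  apply: filterS2 act1_ae (aut_act_ae 1%g E) => x.
  by rewrite invg1 => -> [h1 h2]; split=> // -[[/h2]|[/h1]].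
move=> /cont_phi; rewrite nbhs_simpl /= => nE.
have : \forall v \near (1 : G)%g, (mu (E `+` aut_act (phi v) E) < e%:E)%E by [].
apply: filterS => v; apply: le_lt_trans.
apply: le_measure; rewrite ?inE; [exact: measurableD| |exact: subsetUr].
by apply: measurableU; exact: measurableD.
Qed.

(** Continuity at the identity spreads to uniform continuity because the
    displacement depends only on [h g^-1], by [act_displacement]. *)
Lemma act_uniformly_continuous (dG : G -> G -> R) (E : set X) (e : R) :
  is_metric dG -> compatible dG -> right_invariant dG ->
  measurable E -> 0 < e ->
  exists2 dl, 0 < dl & forall g h, dG g h < dl ->
    (mu (act g @^-1` E `\` act h @^-1` E) < e%:E)%E.
Proof.
move=> metG compG invG mE e0; have := near_displacement mE e0.
rewrite /prop_near1 compG => -[dl /= dl0 dlE]; exists dl => // g h gh.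
rewrite act_displacement//; apply: dlE => /=.
by rewrite -(invG _ _ g) mul1g -mulgA mulVg mulg1.
Qed.

(** The union over the sequence already contains every translate [g A] with
    [g] in [V]: approximate [g] by [v n]; the part of [g A] outside [v n A] has
    the measure of the part of [((v n)^-1 g) A] outside [A], and [(v n)^-1 g] is
    near the identity. *)
Lemma dense_translates (V : set G) (v : nat -> G) (A : set X) g :
  measurable A -> V `<=` closure (range v) -> V g ->
  mu (aut_act (phi g) A `\` \bigcup_n aut_act (phi (v n)) A) = 0%E.
Proof.
move=> mA Vv Vg.
have mgA h := measurable_aut_act h mA.
have mU : measurable (\bigcup_n aut_act (phi (v n)) A).
  exact: bigcupT_measurable.
apply/eqP; rewrite eq_le measure_ge0 andbT; apply/lee_addgt0Pr => e e0.
rewrite add0e.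
have : \forall h \near g, (mu (aut_act (phi (h^-1 * g)%g) A `\` A) < e%:E)%E.
  have /= cvg1 : (h^-1 * g)%g @[h --> g] --> 1%g.
    rewrite -[X in _ --> X](mulVg g).
    apply: (@continuous2_cvg _ _ _ _ _ _ _ _ (fun a b : G => (a * b)%g)).
    - exact: (@mulg_continuous G (g^-1, g)%g).
    - exact: invg_continuous.
    - exact: cvg_cst.
  exact: cvg1 (near_displacement mA e0).
move=> /(Vv _ Vg)[_ [[n _ <-] /ltW]]; apply: le_trans.
have -> : mu (aut_act (phi ((v n)^-1 * g)%g) A `\` A) =
          mu (aut_act (phi g) A `\` aut_act (phi (v n)) A).
  have := act_displacement g^-1%g (v n)^-1%g mA.
  rewrite invgK => <-; apply: measure_ae_eq.
  - by apply: measurableD; exact: measurable_act_preimage.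
  - exact: measurableD.
  - apply: filterS2 (aut_act_ae g A) (aut_act_ae (v n) A) => x.
    by rewrite /setD /= => -> ->.
apply: le_measure; rewrite ?inE; [exact: measurableD..|].
by apply: setDS => x vnAx; exists n.
Qed.

End near_action.

(** * Concentration and transport along a net *)

Lemma eventually_net_filter disp (I : preorderType disp) :
  directed I -> ProperFilter (eventually_net I).
Proof.
move=> [[i0 _] dirI]; apply: filter_from_proper; last first.
  by move=> i _; exists i => /=.
apply: filter_from_filter; first by exists i0.
move=> i j _ _; have [k [ik jk]] := dirI i j; exists k => // l /= kl.
by split; apply: le_trans kl.
Qed.

(** A union of right translates of [V]; hence [mulset V A] is Borel for
    arbitrary [A]. *)
Lemma open_mulset (G : topologicalGroupType) (V A : set G) :
  open V -> open (mulset V A).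
Proof.
move=> oV.
have -> : mulset V A = \bigcup_(a in A) (fun g => g * a^-1)%g @^-1` V.
  rewrite eqEsubset; split=> [_ [v Vv [a Aa <-]]|g [a Aa Vga]].
    by exists a => //=; rewrite -mulgA mulgV mulg1.
  by exists (g * a^-1)%g => //; exists a => //; rewrite -mulgA mulVg mulg1.
apply: bigcup_open => a _; apply: open_comp => // g _.
apply: (@continuous2_cvg _ _ _ _ _ _ _ _ (fun a b : G => (a * b)%g)).
- exact: (@mulg_continuous G (g, a^-1)%g).
- exact: cvg_id.
- exact: cvg_cst.
Qed.

Section Levy.
Context {R : realType} {G : topologicalGroupType}.
Context {disp : Order.disp_t} {I : preorderType disp}.
Variable nu : I -> probability (borel G) R.

(** The definition of a Levy net speaks of one family of sets at a time; this
    is the form uniform over all sets. If it failed, choosing a bad set at each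
    index where there is one, and the whole group elsewhere, would give a family
    contradicting the definition. Uniformity is needed because the sets to which
    it is applied depend on a point of [X]. *)
Lemma Levy_uniform (V : set G) (e : R) : directed I -> Levy_net nu ->
  open V -> V 1%g -> 0 < e ->
  \forall i \near eventually_net I, forall S : set (borel G), measurable S ->
    (e%:E <= nu i S)%E -> ((1 - e)%:E < nu i (mulset V S))%E.
Proof.
move=> dirI levy oV V1 e0.
have FF := eventually_net_filter dirI.
pose bad i := [set S : set (borel G) | [/\ measurable S, (e%:E <= nu i S)%E &
  ~ ((1 - e)%:E < nu i (mulset V S))%E]].
pose A i : set (borel G) := xget setT (bad i).
have mA i : measurable (A i) by rewrite /A; case: xgetP => // S _ [].
have A_ge i : ((Num.min e 1)%:E <= nu i (A i))%E.
  rewrite /A; case: xgetP => [S _ [_ eS _]|_].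
    by apply: le_trans eS; rewrite lee_fin ge_min lexx.
  by rewrite probability_setT lee_fin ge_min lexx orbT.
have liminf_gt0 : (0 < net_liminf (fun i => nu i (A i)))%E.
  have [i0 _] := dirI.1; apply: (@lt_le_trans _ _ (Num.min e 1)%:E).
    by rewrite lte_fin lt_min e0 ltr01.
  apply: (@le_trans _ _ (ereal_inf
    [set nu j (A j) | j in [set j | (i0 <= j)%O]])).
    by apply: le_ereal_inf_tmp => _ [j _ <-].
  by apply: ereal_sup_ubound; exists i0.
have VA1 := levy A mA liminf_gt0 V oV V1.
have nbhs1 : nbhs 1%E [set y : \bar R | ((1 - e)%:E < y)%E].
  apply: open_nbhs_nbhs; split; first exact: open_ereal_gt_ereal.
  by rewrite /= lte_fin ltrBlDr ltrDl.
have : \forall i \near eventually_net I,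
  ((1 - e)%:E < nu i (mulset V (A i)))%E := VA1 _ nbhs1.
apply: filterS => i /= VAi S mS eS; apply/negPn/negP => VS.
have : bad i (A i).
  by apply: (@xgetPex _ setT); exists S; split=> //; exact/negP.
by case=> _ _ /(_ VAi).
Qed.

End Levy.

Section metric_measurability.
Context {R : realType}.

(** Stated for a generating family because a product of two pointed
    topological spaces carries its Borel sets without being a bundled pointed
    topological space. *)
Lemma measurable_superlevel (T : pointedType) (base : set (set T))
    (f : T -> R) :
  (forall c, base [set x | c < f x]) ->
  measurable_fun [set: g_sigma_algebraType base]
    (f : g_sigma_algebraType base -> R).
Proof.
move=> Gf; apply: (measurability _ (RGenOInfty.measurableE R)) => //.
move=> _ [_ [c ->] <-]; rewrite setTI; apply: sub_sigma_algebra.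
rewrite (_ : _ @^-1` _ = [set x | c < f x])//.
by apply/funext => x /=; rewrite in_itv /= andbT.
Qed.

Variables (T : ptopologicalType) (dT : T -> T -> R).
Hypotheses (metT : is_metric dT) (compT : compatible dT).

Lemma uniformly_continuous_measurable (f : T -> R) :
  (forall e : R, 0 < e -> exists2 dl : R, 0 < dl &
    forall x y, dT x y < dl -> f x <= f y + e) ->
  measurable_fun [set: borel T] (f : borel T -> R).
Proof.
move=> uf; apply: measurable_superlevel => c; rewrite openE => x /= cfx.
have [|dl dl0 fdl] := uf ((f x - c) / 2); first lra.
rewrite /interior compT; exists dl => // y /= /fdl; lra.
Qed.

Lemma nbhs_metric_ball x (r : R) : 0 < r -> nbhs x [set y | dT x y < r].
Proof. by move=> r0; rewrite compT; exists r. Qed.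

Lemma open_metric_ball x (r : R) : open [set y | dT x y < r].
Proof.
rewrite openE => y /= xy; rewrite /interior compT.
exists (r - dT x y) => [|z /=].
  by rewrite /= subr_gt0.
have := Defs.metric_triangle metT x y z; lra.
Qed.

Lemma metric_measurable :
  measurable_fun [set: borel (T * T)%type]
    ((fun z => dT z.1 z.2) : borel (T * T)%type -> R).
Proof.
apply: measurable_superlevel => c; rewrite openE => -[x y] /= cxy.
pose r := (dT x y - c) / 2; have r0 : 0 < r by rewrite /r; lra.
exists ([set z | dT x z < r], [set z | dT y z < r]) => /=.
  by split; exact: nbhs_metric_ball.
move=> [x' y'] /= [xx' yy'].
have := Defs.metric_triangle metT x x' y.
have := Defs.metric_triangle metT x' y' y.
rewrite (Defs.metric_sym metT y' y) /r in xx' yy' *; lra.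
Qed.

Local Open Scope ereal_scope.

(** For a coupling of cost less than [eta], compare [f] at the two coordinates:
    where they are [dl]-close the first value exceeds the second by at most [e];
    elsewhere by at most [1], hence by at most the distance divided by [dl]. *)
Lemma dMK_integral_le (mu1 mu2 : probability (borel T) R) (f : T -> R)
    (e dl eta : R) :
  measurable_fun [set: borel T] (f : borel T -> R) ->
  (forall x, 0 <= f x <= 1)%R -> (0 <= e)%R -> (0 < dl)%R ->
  (forall x y, dT x y < dl -> f x <= f y + e)%R ->
  dMK dT mu1 mu2 < eta%:E ->
  \int[mu1]_x (f x)%:E <= \int[mu2]_x (f x)%:E + (e + eta / dl)%:E.
Proof.
move=> mf f01 e0 dl0 fdl /ereal_inf_lt[_ [m coup <-] m_eta].
have mfst : measurable_fun setT (fst : borel (T * T)%type -> borel T).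
  apply: (@measurability _ _ (borel (T * T)%type) (borel T) setT fst
    (@open T)) => //.
  move=> _ [B oB <-]; rewrite setTI; apply: sub_sigma_algebra.
  by apply: open_comp => // z _; exact: cvg_fst.
have msnd : measurable_fun setT (snd : borel (T * T)%type -> borel T).
  apply: (@measurability _ _ (borel (T * T)%type) (borel T) setT snd
    (@open T)) => //.
  move=> _ [B oB <-]; rewrite setTI; apply: sub_sigma_algebra.
  by apply: open_comp => // z _; exact: cvg_snd.
have mF : measurable_fun [set: borel T] (EFin \o f : borel T -> \bar R).
  exact/measurable_EFinP.
have F0 x : 0 <= (f x)%:E by rewrite lee_fin; case/andP: (f01 x).
have -> : \int[mu1]_x (f x)%:E = \int[m]_z (f z.1)%:E.
  rewrite -[RHS](@ge0_integral_pushforward _ _ _ _ _ _ mfst m setT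
    (EFin \o f))//; last by move=> x _; exact: F0.
  by apply: eq_measure_integral => A mA _; have [] := coup A mA.
have -> : \int[mu2]_x (f x)%:E = \int[m]_z (f z.2)%:E.
  rewrite -[RHS](@ge0_integral_pushforward _ _ _ _ _ _ msnd m setT
    (EFin \o f))//; last by move=> x _; exact: F0.
  by apply: eq_measure_integral => A mA _; have [] := coup A mA.
have md := metric_measurable.
have mF1 := measurableT_comp mF mfst.
have mF2 := measurableT_comp mF msnd.
have mD : measurable_fun [set: borel (T * T)%type]
    (fun z : T * T => (dl^-1)%:E * (dT z.1 z.2)%:E).
  by apply: measurable_funeM; exact/measurable_EFinP.
have D0 (z : T * T) : 0 <= (dl^-1)%:E * (dT z.1 z.2)%:E.
  by rewrite mule_ge0// lee_fin ?invr_ge0 ?(ltW dl0)// (Defs.metric_ge0 metT).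
apply: (@le_trans _ _ (\int[m]_z ((f z.2)%:E + e%:E +
    (dl^-1)%:E * (dT z.1 z.2)%:E))).
  apply: ge0_le_integral => //.
  - by apply: emeasurable_funD => //; exact: emeasurable_funD.
  - move=> z _; rewrite -EFinM -!EFinD lee_fin.
    have [/fdl fz|dz] := ltP (dT z.1 z.2) dl.
      apply: (le_trans fz); rewrite lerDl mulr_ge0//.
        by rewrite invr_ge0 ltW.
      exact: Defs.metric_ge0.
    have : (1 <= dl^-1 * dT z.1 z.2)%R by rewrite mulrC ler_pdivlMr// mul1r.
    have /andP[_] := f01 z.1; have /andP[+ _] := f01 z.2; lra.
rewrite ge0_integralD//; last 2 first.
- by move=> z _; rewrite adde_ge0// lee_fin.
- exact: emeasurable_funD.
rewrite ge0_integralD//.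
rewrite integral_probability_cst ge0_integralZl//; last 3 first.
- exact/measurable_EFinP.
- by move=> z _; rewrite lee_fin (Defs.metric_ge0 metT).
- by rewrite lee_fin invr_ge0 ltW.
rewrite EFinD addeA; apply: leeD => //.
by rewrite mulrC EFinM lee_wpmul2l ?ltW// lte_fin invr_gt0.
Qed.

End metric_measurability.

(** * Hitting probabilities of a random measure-preserving map *)

Section random_transformation.
Context {R : realType} {dY dX : measure_display}.
Context {Y : measurableType dY} {X : measurableType dX}.
Variables (nu : probability Y R) (mu : probability X R).
Variable theta : Y * X -> X.
Hypothesis mtheta : measurable_fun setT theta.
Hypothesis theta_pres : forall y (E : set X), measurable E ->
  mu [set x | E (theta (y, x))] = mu E.
Local Open Scope ereal_scope.

(** The function [p_E] of the introduction, when [theta] is the rounded action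
    of a random group element. *)
Definition hitting (E : set X) (x : X) : \bar R :=
  nu [set y | E (theta (y, x))].

Let mpre (E : set X) : measurable E -> measurable (theta @^-1` E).
Proof. by move=> mE; rewrite -[X in measurable X]setTI; exact: mtheta. Qed.

Let hittingE (E : set X) : hitting E = nu \o ysection (theta @^-1` E).
Proof.
apply/funext => x; congr (nu _); apply/seteqP.
by split=> y; rewrite ysectionE.
Qed.

Lemma measurable_transform_section (E : set X) y :
  measurable E -> measurable [set x | E (theta (y, x))].
Proof.
move=> mE; rewrite (_ : [set _ | _] = xsection (theta @^-1` E) y).
  by apply: measurable_xsection; exact: mpre.
by apply/seteqP; split=> x; rewrite xsectionE.
Qed.

Lemma measurable_hitting_set (E : set X) x :
  measurable E -> measurable [set y | E (theta (y, x))].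
Proof.
move=> mE; rewrite (_ : [set _ | _] = ysection (theta @^-1` E) x).
  by apply: measurable_ysection; exact: mpre.
by apply/seteqP; split=> y; rewrite ysectionE.
Qed.

Lemma measurable_hitting (E : set X) :
  measurable E -> measurable_fun setT (hitting E).
Proof.
by move=> mE; rewrite hittingE; apply: measurable_fun_ysection; exact: mpre.
Qed.

Lemma hitting_ge0 (E : set X) x : 0 <= hitting E x.
Proof. exact: measure_ge0. Qed.

Lemma hitting_le1 (E : set X) x : measurable E -> hitting E x <= 1.
Proof. by move=> mE; apply: probability_le1; exact: measurable_hitting_set. Qed.

Let hitting_indic (E : set X) x : measurable E ->
  hitting E x = \int[nu]_y (\1_E (theta (y, x)))%:E.
Proof.
move=> mE; rewrite /hitting -[X in nu X]setIT.
rewrite -integral_indic//; exact: measurable_hitting_set.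
Qed.

(** Tonelli's theorem for the function [f x] restricted to the pairs [(y, x)]
    with [theta (y, x)] in [E]. *)
Lemma fubini_hitting (E : set X) (f : X -> \bar R) : measurable E ->
  measurable_fun setT f -> (forall x, 0 <= f x) ->
  \int[nu]_y \int[mu]_(x in [set x | E (theta (y, x))]) f x =
  \int[mu]_x (f x * hitting E x).
Proof.
move=> mE mf f0.
pose F (z : Y * X) := f z.2 * (\1_E (theta z))%:E.
have mF : measurable_fun setT F.
  apply: emeasurable_funM; first exact: measurableT_comp mf _.
  apply/measurable_EFinP; apply: measurableT_comp mtheta => //.
have F0 z : 0 <= F z by rewrite mule_ge0// lee_fin.
have := fubini_tonelli (m1 := nu) (m2 := mu) F mF F0.
rewrite /F /= => fub.
transitivity (\int[nu]_y \int[mu]_x (f x * (\1_E (theta (y, x)))%:E)).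
  apply: eq_integral => y _; rewrite [LHS]integral_mkcond.
  apply: eq_integral => x _; rewrite patchE indicE.
  have -> : (x \in [set x | E (theta (y, x))]) = (theta (y, x) \in E).
    by apply/idP/idP; rewrite !inE.
  by case: ifPn; rewrite ?mule1 ?mule0.
rewrite fub; apply: eq_integral => x _; rewrite hitting_indic//.
rewrite ge0_integralZl//.
apply/measurable_EFinP; apply: measurableT_comp => //.
exact: measurableT_comp mtheta _.
Qed.

Lemma integral_hitting (E : set X) :
  measurable E -> \int[mu]_x hitting E x = mu E.
Proof.
move=> mE.
have := fubini_hitting mE (f := cst 1) (measurable_cst _) (fun=> lee01).
under [in RHS]eq_integral do rewrite mul1e.
move=> <-; transitivity (\int[nu]_y cst (mu E) y).
  apply: eq_integral => y _; rewrite integral_cst ?mul1e//=.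
    exact: theta_pres.
  exact: measurable_transform_section.
exact: integral_probability_cst.
Qed.

Variable A : set X.
Hypothesis mA : measurable A.

(** Taking the finite part loses nothing, as the integral is at most [mu D];
    real values are what the Monge-Kantorovich estimate is about. *)
Definition hit_mass (D : set X) : R := fine (\int[mu]_(x in D) hitting A x).

Let mhA := measurable_hitting mA.

Lemma integral_hitting_le (D : set X) :
  measurable D -> \int[mu]_(x in D) hitting A x <= mu D.
Proof.
move=> mD; rewrite -[leRHS]mul1e -(integral_cst _ mD).
apply: ge0_le_integral => //.
- exact: measurable_funTS mhA.
- by move=> x _; exact: hitting_le1.
Qed.

Lemma hit_massE (D : set X) : measurable D ->
  (hit_mass D)%:E = \int[mu]_(x in D) hitting A x.
Proof.
move=> mD; rewrite fineK// ge0_fin_numE; last first.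
  by apply: integral_ge0 => x _; exact: hitting_ge0.
apply: le_lt_trans (integral_hitting_le mD) _.
by rewrite ltey_eq fin_num_measure.
Qed.

Lemma hit_mass_ge0 (D : set X) : (0 <= hit_mass D)%R.
Proof. by rewrite fine_ge0// integral_ge0// => x _; exact: hitting_ge0. Qed.

Lemma hit_mass_le (D : set X) : measurable D -> (hit_mass D)%:E <= mu D.
Proof. by move=> mD; rewrite hit_massE// integral_hitting_le. Qed.

Lemma hit_mass_le1 (D : set X) : measurable D -> (hit_mass D <= 1)%R.
Proof.
move=> mD; rewrite -lee_fin (le_trans (hit_mass_le mD))//.
exact: probability_le1.
Qed.

Lemma hit_massT : (hit_mass setT)%:E = mu A.
Proof. by rewrite hit_massE// integral_hitting. Qed.

Lemma hit_mass_subset (D E : set X) : measurable D -> measurable E ->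
  D `<=` E -> (hit_mass D <= hit_mass E)%R.
Proof.
move=> mD mE DE; rewrite -lee_fin !hit_massE//.
apply: ge0_subset_integral => //; exact: measurable_funTS mhA.
Qed.

Lemma hit_massU (D E : set X) : measurable D -> measurable E ->
  (hit_mass (D `|` E) <= hit_mass D + hit_mass E)%R.
Proof.
move=> mD mE; have mED : measurable (E `\` D) by exact: measurableD.
rewrite -lee_fin EFinD !hit_massE//; last exact: measurableU.
rewrite -(setDUK (@subsetUl _ D E)) setDUl setDv set0U.
rewrite ge0_integral_setU//; last 2 first.
- exact: measurable_funTS mhA.
- by apply/disj_setPS => x [Dx [_ /(_ Dx)]].
rewrite leeD2l// -!hit_massE// lee_fin; apply: hit_mass_subset => //.
Qed.

Lemma hit_mass_close (D E : set X) (e : R) : measurable D -> measurable E ->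
  mu (D `\` E) <= e%:E -> (hit_mass D <= hit_mass E + e)%R.
Proof.
move=> mD mE DE; have mDE : measurable (D `\` E) by exact: measurableD.
have DEe : (hit_mass (D `\` E) <= e)%R.
  by rewrite -lee_fin; exact: le_trans (hit_mass_le mDE) DE.
apply: (@le_trans _ _ (hit_mass (E `|` (D `\` E)))).
  apply: hit_mass_subset => //; first exact: measurableU.
  by move=> x Dx; have [|] := pselect (E x); [left|right].
by apply: le_trans (hit_massU mE mDE) _; rewrite lerD2l.
Qed.

Lemma integral_hit_mass (B : set X) : measurable B ->
  \int[nu]_y (hit_mass [set x | B (theta (y, x))])%:E =
  \int[mu]_x (hitting A x * hitting B x).
Proof.
move=> mB; rewrite -fubini_hitting//.
apply: eq_integral => y _; rewrite hit_massE//.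
exact: measurable_transform_section.
Qed.

End random_transformation.

Lemma translate_integral (R : realType) (G : topologicalGroupType) (g : G)
    (nu : probability (borel G) R) (f : G -> R) :
  measurable_fun [set: borel G] (f : borel G -> R) -> (forall h, 0 <= f h) ->
  (\int[nu]_h (f (g * h)%g)%:E = \int[translate g nu]_h (f h)%:E)%E.
Proof.
move=> mf f0.
rewrite (@ge0_integral_pushforward _ _ _ _ _ _ (measurable_ltrans g) nu setT
  (EFin \o f))//.
  exact/measurable_EFinP.
by move=> h _; rewrite lee_fin.
Qed.

(** * Actions of metrized groups *)

Section metrized_action.
Context {R : realType} {G : topologicalGroupType}.
Context {d : measure_display} {X : measurableType d} {mu : probability X R}.
Variable phi : {multiplicative G -> aut mu}.
Hypothesis cont_phi : continuous phi.
Variable dG : G -> G -> R.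
Hypotheses (metG : is_metric dG) (compG : compatible dG)
  (invG : right_invariant dG).
Variable w : nat -> G.
Hypothesis dense_w : forall (g : G) (e : R), 0 < e -> exists n, dG g (w n) < e.

(** By uniform continuity of the action, the union over the dense sequence
    contains every [act g @^-1` B] up to a null set, so it is invariant, and
    ergodicity applies. *)
Lemma ergodic_orbit_full (B : set X) : ergodic phi -> measurable B ->
  (0 < mu B)%E -> mu (\bigcup_n act phi (w n) @^-1` B) = 1%E.
Proof.
move=> erg_phi mB B0; set Z := \bigcup_n _.
have mwB n : measurable (act phi (w n) @^-1` B).
  exact: measurable_act_preimage.
have mZ : measurable Z by exact: bigcupT_measurable.
have hBZ h : mu (act phi h @^-1` B `\` Z) = 0%E.
  apply/eqP; rewrite eq_le measure_ge0 andbT; apply/lee_addgt0Pr => e e0.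
  rewrite add0e.
  have [dl dl0 dlB] :=
    act_uniformly_continuous cont_phi metG compG invG mB e0.
  have [n hn] := dense_w h dl0; apply: le_trans (ltW (dlB _ _ hn)).
  apply: le_measure; rewrite ?inE.
  - by apply: measurableD => //; exact: measurable_act_preimage.
  - by apply: measurableD => //; exact: measurable_act_preimage.
  - by apply: setDS => x wnBx; exists n.
have gZZ g : mu (act phi g @^-1` Z `\` Z) = 0%E.
  apply/negligibleP.
    by apply: measurableD => //; exact: measurable_act_preimage.
  apply: (@negligibleS _ _ _ _
    (\bigcup_n (act phi g @^-1` (act phi (w n) @^-1` B) `\` Z))).
    by move=> x [[n _ wnB] nZ]; exists n.
  apply: negligible_bigcup => n; apply/negligibleP.
    by apply: measurableD => //; do 2 apply: measurable_act_preimage.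
  rewrite -(hBZ (w n * g)%g); apply: measure_ae_eq.
  - by apply: measurableD => //; do 2 apply: measurable_act_preimage.
  - by apply: measurableD => //; exact: measurable_act_preimage.
  - by apply: filterS (actM_ae phi (w n) g) => x; rewrite /setD /= => ->.
have mgZ g : measurable (aut_act (phi g) Z) by exact: measurable_aut_act.
have [] // := erg_phi Z mZ.
  move=> g; apply: measure_negligible.
    by apply: measurableU; exact: measurableD.
  apply: negligibleU; apply/negligibleP; try exact: measurableD.
    transitivity (mu (act phi g @^-1` (Z `\` aut_act (phi g) Z))).
      by apply/esym/measure_act_preimage; exact: measurableD.
    rewrite -(gZZ g) -[LHS]/(mu (_ `\` act phi g @^-1` aut_act (phi g) Z)).
    by rewrite act_preimage_act.
  rewrite -(gZZ g^-1%g); apply: measure_ae_eq.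
  - exact: measurableD.
  - by apply: measurableD => //; exact: measurable_act_preimage.
  - by apply: filterS (aut_act_ae phi g Z) => x; rewrite /setD /= => ->.
move=> Z0; suff : (mu B <= mu Z)%E by rewrite Z0 leNgt B0.
rewrite -(measure_act_preimage phi (w 0%N) mB).
by apply: le_measure; rewrite ?inE//; move=> x wB; exists 0%N.
Qed.

Lemma ergodic_finite_orbit (B : set X) (c : \bar R) :
  ergodic phi -> measurable B -> (0 < mu B)%E -> (c < 1)%E ->
  exists r, (c < mu (\big[setU/set0]_(n < r) (act phi (w n) @^-1` B)))%E.
Proof.
move=> erg_phi mB B0 c1.
have mwB n : measurable (act phi (w n) @^-1` B).
  exact: measurable_act_preimage.
pose F r := \big[setU/set0]_(n < r) (act phi (w n) @^-1` B).
have F1 : mu (F r) @[r --> \oo] --> mu (\bigcup_r F r).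
  apply: nondecreasing_cvg_mu => //.
  - by move=> r; exact: bigsetU_measurable.
  - by apply: bigcupT_measurable => r; exact: bigsetU_measurable.
  - move=> m n mn; apply/subsetPset.
    exact: (@subset_bigsetU _ (fun n => act phi (w n) @^-1` B)).
have FZ : \bigcup_r F r = \bigcup_n act phi (w n) @^-1` B.
  rewrite eqEsubset; split=> x.
    by case=> r _; exact: (@bigsetU_bigcup _ (fun n => act phi (w n) @^-1` B)).
  case=> n _ wnBx; exists n.+1 => //.
  exact: (@bigsetU_sup _ n n.+1 (fun n => act phi (w n) @^-1` B)).
move: F1; rewrite FZ ergodic_orbit_full// => F1.
have /F1 : nbhs 1%E [set y : \bar R | (c < y)%E].
  by apply: open_nbhs_nbhs; split=> //; exact: open_ereal_gt_ereal.
by case=> r _ /(_ r (leqnn r)); exists r.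
Qed.

(** Taking for [n g] the least admissible index makes each level set a ball
    minus a finite union of balls, hence Borel. *)
Lemma measurable_index (rho : R) : 0 < rho ->
  exists2 n : G -> nat, (forall g, dG g (w (n g)) < rho) &
    forall k, measurable ([set g | n g = k] : set (borel G)).
Proof.
move=> rho0; have ex g : exists k, dG g (w k) < rho by exact: dense_w.
exists (fun g => ex_minn (ex g)) => [g|k]; first by case: ex_minnP.
have mball k' : measurable ([set g | dG g (w k') < rho] : set (borel G)).
  apply: sub_sigma_algebra.
  rewrite /= (_ : [set _ | _] = [set g | dG (w k') g < rho]).
    exact: open_metric_ball.
  by apply/funext => g /=; rewrite (Defs.metric_sym metG).
rewrite (_ : [set _ | _] = [set g | dG g (w k) < rho] `\`
    \bigcup_(j in `I_k) [set g | dG g (w j) < rho]).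
  by apply: measurableD => //; exact: bigcup_measurable.
apply/seteqP; split=> g /=.
  case: ex_minnP => m gm m_min <-; split=> // -[j /= jm gj].
  by have := m_min _ gj; rewrite leqNgt jm.
case=> gk nk; case: ex_minnP => m gm m_min; apply/eqP.
rewrite eqn_leq m_min// leqNgt; apply/negP => mk; apply: nk.
by exists m.
Qed.

Section rounding.
Variable n : G -> nat.
Hypothesis mn : forall k, measurable ([set g | n g = k] : set (borel G)).

(** Since [n] takes countably many values, this substitute for [act g x] is
    jointly measurable. *)
Definition rounded_act (z : borel G * X) : X := act phi (w (n z.1)) z.2.

Lemma measurable_rounded_act : measurable_fun setT rounded_act.
Proof.
move=> _ E mE; rewrite setTI.
rewrite (_ : _ @^-1` _ = \bigcup_k
   (([set g | n g = k] : set (borel G)) `*` (act phi (w k) @^-1` E))).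
  apply: bigcupT_measurable => k; apply: measurableX => //.
  exact: measurable_act_preimage.
apply/seteqP; split=> [[g x] /= Egx|[g x] [k _ /= [<-]]//].
by exists (n g).
Qed.

Lemma rounded_act_pres (g : borel G) (E : set X) : measurable E ->
  mu [set x | E (rounded_act (g, x))] = mu E.
Proof. by move=> mE; exact: (measure_act_preimage phi (w (n g)) mE). Qed.

Variable nu : probability (borel G) R.
Variables (A B : set X) (mA : measurable A) (mB : measurable B).

Notation hit E := (hitting nu rounded_act E).

(** For almost every [x], let [S] and [S'] be the sets of those [g] whose
    rounded action moves [x] into [A], respectively into [B]. Rounding moves
    each of two elements by less than [rho], so the [rho]-neighbourhood of [S]
    is disjoint from [S']: otherwise points of the dense sequence at distance
    less than [3 * rho] would move [x] into [A] and into [B]. By concentration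
    one of [S], [S'] has measure less than [e], and the other at most [1]. *)
Lemma hitting_product_small (e rho : R) : 0 < e ->
  (forall g, dG g (w (n g)) < rho) ->
  (forall g h, dG g h < 3 * rho ->
     mu (act phi g @^-1` A `&` act phi h @^-1` B) = 0%E) ->
  (forall S : set (borel G), measurable S -> (e%:E <= nu S)%E ->
     ((1 - e)%:E < nu (mulset [set v | (dG 1%g v < rho)%R] S))%E) ->
  (\int[mu]_x (hit A x * hit B x) <= e%:E)%E.
Proof.
move=> e0 n_rho sepAB conc.
have mth := measurable_rounded_act.
have mhA := measurable_hitting nu mth mA.
have mhB := measurable_hitting nu mth mB.
have hA0 := hitting_ge0 nu rounded_act A.
have hB0 := hitting_ge0 nu rounded_act B.
have hA1 x := hitting_le1 nu mth x mA.
have hB1 x := hitting_le1 nu mth x mB.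
apply: (@le_trans _ _ (\int[mu]_x cst e%:E x)%E); last first.
  by rewrite integral_probability_cst.
apply: ae_ge0_le_integral => //.
- by move=> x _; rewrite mule_ge0.
- exact: emeasurable_funM.
- by move=> x _; rewrite lee_fin ltW.
(* Pairs of indices are coded by natural numbers, for a union over [nat]. *)
have sep : \forall x \ae mu, forall k m, dG (w k) (w m) < 3 * rho ->
    ~ (A (act phi (w k) x) /\ B (act phi (w m) x)).
  pose N (km : nat) := if unpickle km is Some (k, m) then
    if dG (w k) (w m) < 3 * rho then
      act phi (w k) @^-1` A `&` act phi (w m) @^-1` B else set0 else set0.
  have : mu.-negligible (\bigcup_km N km).
    apply: negligible_bigcup => km; rewrite /N.
    case: unpickle => [[k m]|]; last exact: negligible_set0.
    case: ifPn => [km3|_]; last exact: negligible_set0.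
    apply/negligibleP; last exact: sepAB.
    by apply: measurableI; exact: measurable_act_preimage.
  apply: negligibleS => x /=.
  move=> /existsNP[k /existsNP[m /not_implyP[km /contrapT]]].
  by exists (pickle (k, m)) => //; rewrite /N pickleK km.
apply: filterS sep => x sepx _ /=.
set S := [set g : borel G | A (rounded_act (g, x))].
set S' := [set g : borel G | B (rounded_act (g, x))].
have mS : measurable S := measurable_hitting_set mth x mA.
have mS' : measurable S' := measurable_hitting_set mth x mB.
have [|Se] := leP e%:E (nu S); last first.
  rewrite -[leRHS]mule1; apply: lee_pmul => //; exact: ltW.
move=> /(conc S mS); set VS := mulset _ _ => VSe.
have mVS : measurable (VS : set (borel G)).
  apply: sub_sigma_algebra; apply: open_mulset; exact: open_metric_ball.
have VSS' : S' `<=` ~` VS.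
  move=> t S't [v /= v_rho [g Sg vg]]; rewrite -{t}vg in S't.
  apply: (sepx (n g) (n (v * g)%g)); last by split.
  have := n_rho g; have := n_rho (v * g)%g.
  have : dG g (v * g)%g < rho by rewrite -[X in dG X _]mul1g invG.
  have := Defs.metric_triangle metG (w (n g)) g (w (n (v * g)%g)).
  have := Defs.metric_triangle metG g (v * g)%g (w (n (v * g)%g)).
  rewrite (Defs.metric_sym metG (w (n g)) g); lra.
rewrite -[leRHS]mul1e; apply: lee_pmul => //.
apply: (@le_trans _ _ (nu (~` VS))).
  by apply: le_measure; rewrite ?inE//; exact: measurableC.
rewrite probability_setC//.
rewrite leeBlDr ?fin_num_measure//.
apply: (@le_trans _ _ (e%:E + (1 - e)%:E)%E).
  by rewrite -EFinD lee_fin; lra.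
by rewrite leeD2l// ltW.
Qed.

End rounding.

(** In the notation of the introduction, with [psi = psi_B]: [m B] is the
    integral of [psi], and [m (act (w j) @^-1` B)] that of
    [g |-> psi (w j * g)]. Each of the latter is at most [4 * e]: one [e] for
    the product of the hitting probabilities, one for rounding [g] in [psi],
    and two for the transport from the translated measure to [nu], namely the
    modulus of continuity of [psi] and the cost [dl * e] divided by [dl]. The
    first term on the right bounds what [m] gives to the points not covered by
    the [act (w j) @^-1` B]. *)
Lemma separated_mass_bound (nu : probability (borel G) R)
    (A B : set X) (e dl rho : R) (r : nat) :
  measurable A -> measurable B ->
  0 < e -> 0 < dl -> 0 < rho -> rho <= dl ->
  (forall g h, dG g h < 3 * rho ->
     mu (act phi g @^-1` A `&` act phi h @^-1` B) = 0%E) ->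
  (forall g h, dG g h < dl ->
     (mu (act phi g @^-1` B `\` act phi h @^-1` B) < e%:E)%E) ->
  (forall S : set (borel G), measurable S -> (e%:E <= nu S)%E ->
     ((1 - e)%:E < nu (mulset [set v | (dG 1%g v < rho)%R] S))%E) ->
  (forall j, (j < r)%N -> (dMK dG (translate (w j) nu) nu < (dl * e)%:E)%E) ->
  (mu A <= mu (~` (\big[setU/set0]_(j < r) (act phi (w j) @^-1` B)))
           + (r%:R * (4 * e))%:E)%E.
Proof.
move=> mA mB e0 dl0 rho0 rho_dl sepAB unifB conc MK.
have [n n_rho mn] := measurable_index rho0.
have mth := measurable_rounded_act mn.
pose M := hit_mass nu mu (rounded_act n) A.
have mact g (E : set X) : measurable E -> measurable (act phi g @^-1` E).
  exact: measurable_act_preimage.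
have M0 D : 0 <= M D by exact: hit_mass_ge0.
have M1 D : measurable D -> M D <= 1 by exact: (hit_mass_le1 nu mu mth mA).
have Mle D : measurable D -> ((M D)%:E <= mu D)%E.
  exact: (hit_mass_le nu mu mth mA).
have Mclose (D E : set X) c : measurable D -> measurable E ->
    (mu (D `\` E) <= c%:E)%E -> M D <= M E + c.
  exact: (hit_mass_close nu mth mA).
have MT : (M setT)%:E = mu A.
  exact: (hit_massT nu mth (rounded_act_pres n) mA).
have MU D E : measurable D -> measurable E -> M (D `|` E) <= M D + M E.
  exact: (hit_massU nu mu mth mA).
pose psi g := M (act phi g @^-1` B).
have mB' g : measurable (act phi g @^-1` B) by exact: mact.
have psi01 g : 0 <= psi g <= 1 by rewrite M0 M1.
have mpsi : measurable_fun [set: borel G] (psi : borel G -> R).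
  apply: (uniformly_continuous_measurable compG) => c c0.
  have [dl' dl'0 ucB] :=
    act_uniformly_continuous cont_phi metG compG invG mB c0.
  by exists dl' => // g h /ucB /ltW; exact: Mclose.
(* The rounding error is controlled by [unifB], since [rho <= dl]. *)
have psi_small : (\int[nu]_g (psi g)%:E <= (2 * e)%:E)%E.
  have mw : measurable_fun [set: borel G] (fun g : borel G => psi (w (n g))).
    move=> _ U mU; rewrite setTI (_ : _ @^-1` _ =
      \bigcup_(k in [set k | U (psi (w k))]) [set g | n g = k]).
      by apply: bigcup_measurable.
    apply/seteqP; split=> [g /= Ug|g [k /= Uk ->]//].
    by exists (n g).
  apply: (@le_trans _ _ (\int[nu]_g ((psi (w (n g)))%:E + e%:E))%E).
    apply: ge0_le_integral => //.
    - by move=> g _; rewrite lee_fin M0.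
    - exact/measurable_EFinP.
    - by apply: emeasurable_funD => //; exact/measurable_EFinP.
    - move=> g _; rewrite -EFinD lee_fin; apply: Mclose => //.
      by apply/ltW/unifB; apply: lt_le_trans rho_dl.
  rewrite ge0_integralD//; last 3 first.
  - by move=> g _; rewrite lee_fin M0.
  - exact/measurable_EFinP.
  - by move=> g _; rewrite lee_fin ltW.
  rewrite integral_probability_cst (_ : 2 * e = e + e); last lra.
  rewrite EFinD leeD2r//.
  have := hitting_product_small mn mA mB e0 n_rho sepAB conc.
  by apply: le_trans; rewrite -(integral_hit_mass nu mu mth mA mB).
have psi_trans j : (j < r)%N ->
    (\int[nu]_g (psi (w j * g)%g)%:E <= (4 * e)%:E)%E.
  move=> /MK MKj; rewrite translate_integral//; last by move=> g; exact: M0.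
  have uc g h : dG g h < dl -> psi g <= psi h + e.
    by move=> /unifB /ltW; exact: Mclose.
  apply: le_trans (dMK_integral_le metG compG mpsi psi01 (ltW e0) dl0 uc MKj) _.
  rewrite (_ : 4 * e = 2 * e + (e + dl * e / dl)).
    by rewrite [in leRHS]EFinD leeD2r.
  by rewrite mulrAC divff ?gt_eqF// mul1r; lra.
have unionM g k :
    M (act phi g @^-1` \big[setU/set0]_(j < k) (act phi (w j) @^-1` B)) <=
    \sum_(j < k) psi (w j * g)%g.
  elim: k => [|k IH].
    rewrite !big_ord0 -lee_fin; apply: le_trans (Mle _ _) _; first exact: mact.
    by rewrite preimage_set0 measure0.
  rewrite !big_ord_recr /= preimage_setU.
  have mk : measurable (\big[setU/set0]_(j < k) (act phi (w j) @^-1` B)).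
    exact: bigsetU_measurable.
  apply: le_trans (MU _ _ (mact g _ mk) (mact g _ (mB' (w k)))) _.
  apply: lerD => //; rewrite -[leRHS]addr0.
  apply: Mclose => //; first exact: mact.
  rewrite (@measure_ae_eq _ _ _ mu _ set0) ?measure0//.
    by apply: measurableD => //; exact: mact.
  by apply: filterS (actM_ae phi (w k) g) => x; rewrite /setD /= => ->; tauto.
set U := \big[setU/set0]_(j < r) _.
have mU : measurable U by apply: bigsetU_measurable.
have finU : mu (~` U) \is a fin_num.
  by apply: fin_num_measure; exact: measurableC.
(* Averaging this inequality over [g] splits [m] of the whole space. *)
have pointwise g : M setT <= fine (mu (~` U)) + \sum_(j < r) psi (w j * g)%g.
  rewrite -(setUv (act phi g @^-1` U)) setUC.
  have mgU := mact g _ mU; apply: le_trans (MU _ _ (measurableC mgU) mgU) _.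
  apply: lerD.
    rewrite -lee_fin (fineK finU).
    rewrite -(measure_act_preimage phi g (measurableC mU)).
    exact: (Mle _ (measurableC mgU)).
  exact: unionM.
have mpsij j : measurable_fun [set: borel G]
    (fun g : borel G => (psi (w j * g)%g)%:E).
  apply/measurable_EFinP; apply: (measurableT_comp mpsi).
  exact: measurable_ltrans.
rewrite -MT -(integral_probability_cst nu (M setT)%:E).
apply: (@le_trans _ _ (\int[nu]_g ((fine (mu (~` U)))%:E +
    \sum_(j < r) (psi (w j * g)%g)%:E))%E).
  apply: ge0_le_integral => //.
  - by move=> g _; rewrite lee_fin.
  - apply: emeasurable_funD => //; exact: emeasurable_sum.
  - by move=> g _; rewrite sumEFin -EFinD lee_fin.
rewrite ge0_integralD//; last 3 first.
- by move=> g _; rewrite lee_fin fine_ge0.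
- by move=> g _; apply: sume_ge0 => j _; rewrite lee_fin M0.
- exact: emeasurable_sum.
rewrite integral_probability_cst (fineK finU).
apply: leeD => //; rewrite ge0_integral_sum//; last first.
  by move=> j g _; rewrite lee_fin M0.
apply: (@le_trans _ _ (\sum_(j < r) (4 * e)%:E)%E).
  by apply: lee_sum => j _; exact: psi_trans.
by rewrite sumEFin sumr_const card_ord (mulr_natl (4 * e)).
Qed.


End metrized_action.

(** * Whirliness *)

Lemma separable_metric_seq (R : realType) (T : ptopologicalType)
    (dT : T -> T -> R) (D : set T) :
  is_metric dT -> compatible dT -> countable D -> dense D ->
  exists w : nat -> T, forall x (e : R), 0 < e -> exists n, dT x (w n) < e.
Proof.
move=> metT compT /countable_injP[f injf] denseD.
exists (fun n => xget point [set x | D x /\ f x = n]) => x e e0.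
have oball := open_metric_ball metT compT x e.
have [|y [/= xy Dy]] := denseD [set y | dT x y < e] _ oball.
  by exists x => /=; have [_ ->] := metric_eq0 metT x x.
exists (f y); case: xgetP => [z _ [Dz fz]|/(_ y)]; last by case.
by have -> : z = y by apply: injf; rewrite ?inE.
Qed.

Theorem corollary5p9 (R : realType) (G : topologicalGroupType)
  (polishG : polish R G)
  (disp : Order.disp_t) (I : preorderType disp) (dirI : directed I)
  (nu : I -> probability (borel G) R)
  (levy_nu : Levy_net nu) (inv_nu : MK_invariant_net nu)
  (d : measure_display) (X : measurableType d) (mu : probability X R)
  (stdX : standard_borel R X) (nonatomic_mu : nonatomic mu)
  (phi : {multiplicative G -> aut mu}) (cont_phi : continuous phi)
  (erg_phi : ergodic phi) :
  whirly phi.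
Proof.
move=> A mA A0 V nbhsV v vV denseV.
have [[D [cD dD]] _] := polishG.
have [dG [metG compG invG invnu]] := inv_nu.
have [w dense_w] := separable_metric_seq metG compG cD dD.
set U := \bigcup_n _.
have mU : measurable U.
  by apply: bigcupT_measurable => n; exact: measurable_aut_act.
apply/eqP; rewrite eq_le probability_le1//= leNgt; apply/negP => U1.
pose B := ~` U; have mB : measurable B by exact: measurableC.
have B0 : (0 < mu B)%E.
  by rewrite probability_setC// sube_gt0.
have [r0 /= r0_gt0 r0V] : filter_from [set e : R | 0 < e]
    (fun e => [set y | dG 1%g y < e]) V by rewrite -compG.
pose a := fine (mu A).
have aE : mu A = a%:E by rewrite fineK// fin_num_measure.
have a0 : 0 < a by rewrite -lte_fin -aE.
have [|r Ur] := ergodic_finite_orbit cont_phi metG compG invG dense_w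
  erg_phi mB B0 (c := (1 - a / 2)%:E).
  by rewrite lte_fin; lra.
(* The [r] translates of [B] receive [r * (4 * e) <= a / 4] in total. *)
pose e := a / (16 * r.+1%:R).
have e0 : 0 < e by rewrite divr_gt0// mulr_gt0// ltr0n.
have [dl dl0 unifB] :=
  act_uniformly_continuous cont_phi metG compG invG mB e0.
(* [rho <= dl] bounds the rounding error; [3 * rho <= r0] keeps products of
   rounded elements in [V]. *)
pose rho := Num.min dl (r0 / 3).
have rho0 : 0 < rho by rewrite lt_min dl0 divr_gt0.
have rho_dl : rho <= dl by rewrite ge_min lexx.
have rho_r0 : 3 * rho <= r0.
  by rewrite mulrC -ler_pdivlMr// ge_min lexx orbT.
have sepAB g h : dG g h < 3 * rho ->
    mu (act phi g @^-1` A `&` act phi h @^-1` B) = 0%E.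
  move=> gh; rewrite act_preimageI// -setDE.
  apply: (dense_translates cont_phi mA denseV); apply: r0V => /=.
  apply: lt_le_trans rho_r0; rewrite -(invG _ _ g) mul1g -mulgA mulVg.
  by rewrite mulg1.
have FF := eventually_net_filter dirI.
have conc :=
  Levy_uniform dirI levy_nu (open_metric_ball metG compG 1%g rho) _ e0.
have MK : \forall i \near eventually_net I, forall j : 'I_r,
    (dMK dG (translate (w j) (nu i)) (nu i) < (dl * e)%:E)%E.
  apply: filter_forall => j.
  have nbhs0 : nbhs 0%E [set y : \bar R | (y < (dl * e)%:E)%E].
    apply: open_nbhs_nbhs; split; first exact: open_ereal_lt_ereal.
    by rewrite /= lte_fin mulr_gt0.
  exact: (invnu (w j) _ nbhs0).
have [|i [conci MKi]] := filter_ex (filterI (conc _) MK).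
  by rewrite /=; have [_ ->] := metric_eq0 metG 1%g 1%g.
have := separated_mass_bound cont_phi metG compG invG dense_w mA mB
  e0 dl0 rho0 rho_dl sepAB unifB conci (r := r).
move=> /(_ (fun j jr => MKi (Ordinal jr))).
rewrite leNgt => /negP; apply.
set Ur' := \big[setU/set0]_(j < r) _ in Ur *.
have mUr : measurable Ur'.
  by apply: bigsetU_measurable => j _; exact: measurable_act_preimage.
have : (mu (~` Ur') < (a / 2)%:E)%E.
  rewrite probability_setC// lteBlDr ?fin_num_measure//.
  by move: Ur; rewrite -lteBlDl// -EFinB; congr (_ < _)%E; congr _%:E; lra.
move=> Ura; rewrite aE (_ : a = a / 2 + a / 2); last lra.
rewrite EFinD lteD// lte_fin.
have eE : e * (16 * r.+1%:R) = a by rewrite divfK// mulf_neq0// pnatr_eq0.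
have : r%:R * e <= r.+1%:R * e by apply: ler_wpM2r; rewrite ?(ltW e0)// ler_nat.
lra.
Qed.
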